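(* Let $X$ and $Y$ be compact metric spaces with their Borel $\sigma$-algebras, $\nu$ a Borel probability on $X$ and $\pi$ a Borel probability on $X\times Y$. Then \[H^{\nu}(\pi)=-\sup\Big\{\int f\,d\pi\ :\ f:X\times Y\to\mathbb{R}\ \text{Lipschitz},\ \int e^{f(x,y)}\,d\nu(x)=1\ \forall y\in Y\Big\}.\]
   Context: $\mathcal{F}(\pi)$ is the set of measurable functions whose $\pi$-integral is well defined (not $+\infty-\infty$), and $H^{\nu}(\pi)=-\sup\{\int c\,d\pi:\ c\in\mathcal{F}(\pi),\ \int e^{c(x,y)}\,d\nu(x)=1\ \forall y\in Y\}$ (supremum over measurable functions). *)

(* Defs.v *)
From HB Require Import structures.
From mathcomp Require Import all_boot all_order all_algebra.
From mathcomp Require Import all_classical all_reals all_analysis.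
Set Implicit Arguments. Unset Strict Implicit. Unset Printing Implicit Defensive.
Import Order.TTheory GRing.Theory Num.Theory.
Local Open Scope classical_set_scope.
Local Open Scope ring_scope.

Definition is_metric (R : realType) (T : Type) (d : T -> T -> R) : Prop :=
  [/\ forall x y, 0 <= d x y,
      forall x y, d x y = 0 <-> x = y,
      forall x y, d x y = d y x &
      forall x y z, d x z <= d x y + d y z].

Definition metric_open (R : realType) (T : Type) (d : T -> T -> R) (U : set T) : Prop :=
  forall x, U x -> exists2 r : R, 0 < r & [set y | d x y < r] `<=` U.

Definition metric_compact (R : realType) (T : Type) (d : T -> T -> R) : Prop :=
  forall (I : Type) (U : I -> set T), (forall i, metric_open d (U i)) ->
    [set: T] `<=` \bigcup_(i in [set: I]) U i ->
    exists2 F : set I, finite_set F & [set: T] `<=` \bigcup_(i in F) U i.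

Definition borel_for (R : realType) (disp : measure_display) (T : measurableType disp)
  (d : T -> T -> R) : Prop :=
  (@measurable _ T) = <<s metric_open d >>.

Definition prod_dist (R : realType) (X Y : Type) (dX : X -> X -> R) (dY : Y -> Y -> R)
  (p q : X * Y) : R := dX p.1 q.1 + dY p.2 q.2.

Definition lipschitz_wrt (R : realType) (T : Type) (d : T -> T -> R) (f : T -> R) : Prop :=
  exists L : R, forall p q, `|f p - f q| <= L * d p q.

Definition integral_defined (R : realType) (disp : measure_display) (T : measurableType disp)
  (mu : {measure set T -> \bar R}) (c : T -> R) : Prop :=
  (\int[mu]_z (Num.max (c z) 0)%:E < +oo)%E \/ (\int[mu]_z (Num.max (- c z) 0)%:E < +oo)%E.

Definition nu_normalized (R : realType) (d1 d2 : measure_display)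
  (X : measurableType d1) (Y : measurableType d2) (nu : {measure set X -> \bar R})
  (c : X * Y -> R) : Prop :=
  forall y : Y, (\int[nu]_x (expR (c (x, y)))%:E = 1)%E.

Definition Hnu (R : realType) (d1 d2 : measure_display)
  (X : measurableType d1) (Y : measurableType d2)
  (nu : {measure set X -> \bar R}) (pi : {measure set (X * Y)%type -> \bar R}) : \bar R :=
  (- ereal_sup [set \int[pi]_z (c z)%:E | c in
      [set c : X * Y -> R | [/\ measurable_fun [set: X * Y] c,
                                integral_defined pi c & nu_normalized nu c]]])%E.

(* Main.v *)
Require Import Defs.
From HB Require Import structures.
From mathcomp Require Import all_boot all_order all_algebra.
From mathcomp Require Import all_classical all_reals all_analysis.
From mathcomp Require Import measurable_realfun lra.
Import Order.TTheory GRing.Theory Num.Theory.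
Import numFieldNormedType.Exports.
Local Open Scope classical_set_scope.
Local Open Scope ring_scope.

Set Implicit Arguments.
Unset Strict Implicit.

                                                                                 
                                                                              
                                                   
                                                 
                                                                              
                                                                               
                                                                               
                                                                             
                                                                             
                                                                                
                         

                                                     

(** A Lipschitz function on a product of compact spaces is bounded and measurable, so it is
    admissible in the definition of [Hnu]; this gives one inequality between the two suprema. The
    content is the other one: every admissible [c] satisfies $\int c\,d\pi\le S$ whenever $S$ bounds
    the integrals of normalized Lipschitz functions.

    The difficulty is that the constraint $\int e^{c(x,y)}\,d\nu(x)=1$ for every $y$ is destroyed by
    approximation. It is replaced by a penalty. Let $\rho=\nu\otimes\pi_Y$, with $\pi_Y$ the second
    marginal of $\pi$, and $J(g)=\int g\,d\pi-\int e^g\,d\rho+1$. For a Lipschitz $g$ put $A(y)=\int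
    e^{g(x,y)}\,d\nu(x)$. Then $f=g-\ln A$ is normalized and again Lipschitz, and $\ln A\le A-1$
    gives $\int f\,d\pi\ge J(g)$ ([exists_normalized_lipschitz]). On functions with a common bound,
    $J$ is continuous for the $L^1(\pi+\rho)$ distance, and Lipschitz functions are dense there
    ([lip_approx_bounded], [lip_approx_indic_prod]), so $J(b)$ is reached up to $\varepsilon$ for
    every bounded measurable $b$ ([normalized_lipschitz_bounded]).

    For an admissible $c$, the truncation $b=\max(\min(c,n),-K)$ has $\int e^b\,d\rho\le 1+e^{-K}$,
    so $J(b)$ is almost at least $\int b\,d\pi$. Taking $K$ large and then $n\to\infty$ by monotone
    convergence gives $\int c\,d\pi\le S$ ([le_Hnu_lipschitz]). *)

(** * Lipschitz functions on compact metric spaces: boundedness and measurability *)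

Lemma is_metric_prod_dist (R : realType) (X Y : Type) (dX : X -> X -> R)
    (dY : Y -> Y -> R) :
  is_metric dX -> is_metric dY -> is_metric (prod_dist dX dY).
Proof.
move=> [x0 xz xs xt] [y0 yz ys yt]; rewrite /prod_dist; split.
- by move=> p q; rewrite addr_ge0.
- move=> [x y] [x' y'] /=; split.
    by move/eqP; rewrite paddr_eq0// => /andP[/eqP/xz-> /eqP/yz->].
  by case=> <- <-; rewrite (xz x x).2// (yz y y).2// addr0.
- by move=> p q; rewrite xs ys.
- by move=> p q r; rewrite addrACA lerD.
Qed.

Lemma lipschitz_wrt_le (R : realType) (T : Type) (d : T -> T -> R) (f : T -> R) :
  is_metric d -> lipschitz_wrt d f ->
  exists2 L : R, 0 < L & forall p q, f p <= f q + L * d p q.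
Proof.
move=> [d0 _ _ _] [L fL]; exists (`|L| + 1); first by rewrite ltr_wpDl.
move=> p q; rewrite -lerBlDl (le_trans (ler_norm _))// (le_trans (fL p q))//.
by rewrite ler_wpM2r// (le_trans (ler_norm _))// lerDl.
Qed.

Lemma le_lipschitz_wrt (R : realType) (T : Type) (d : T -> T -> R) (f : T -> R)
    (L : R) :
  is_metric d -> (forall p q, f p <= f q + L * d p q) -> lipschitz_wrt d f.
Proof.
move=> [_ _ ds _] fL; exists L => p q.
by rewrite ler_norml lerNl opprB !lerBlDl fL ds fL.
Qed.

Lemma measurable_metric_open (R : realType) (disp : measure_display)
    (T : measurableType disp) (d : T -> T -> R) (U : set T) :
  borel_for d -> metric_open d U -> measurable U.
Proof. by move=> bd oU; rewrite bd; exact: sub_sigma_algebra. Qed.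

Lemma measurable_lipschitz (R : realType) (disp : measure_display)
    (T : measurableType disp) (d : T -> T -> R) (f : T -> R) :
  is_metric d -> borel_for d -> lipschitz_wrt d f -> measurable_fun setT f.
Proof.
move=> md bd /(lipschitz_wrt_le md)[L L0 fL].
have [_ _ ds _] := md.
move=> mT; apply: (measurability _ (RGenOInfty.measurableE R)) => //.
move=> _ [_ [a ->] <-]; rewrite setTI; apply: (measurable_metric_open bd).
move=> x /=; rewrite in_itv/= andbT => ax; exists ((f x - a) / L).
  by rewrite divr_gt0// subr_gt0.
move=> y /=; rewrite in_itv/= andbT ltr_pdivlMr// mulrC => xy.
by have := fL x y; lra.
Qed.

Lemma metric_compact_totally_bounded (R : realType) (T : choiceType)
    (d : T -> T -> R) (r : R) :
  is_metric d -> metric_compact d -> 0 < r ->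
  exists s : seq T, forall x, exists2 z, z \in s & d z x < r.
Proof.
move=> [_ dz _ dt] cd r0.
have [| |F /finite_seqP[s ->] cF] := cd T (fun z => [set x | d z x < r]).
- move=> z x /= zx; exists (r - d z x); first by rewrite subr_gt0.
  by move=> y /=; have := dt z x y; lra.
- by move=> x _; exists x => //=; rewrite (dz x x).2.
- by exists s => x; have [z /= zs zx] := cF x I; exists z.
Qed.

Lemma metric_compact_bounded (R : realType) (T : choiceType) (d : T -> T -> R) :
  is_metric d -> metric_compact d -> exists D : R, forall x y, d x y <= D.
Proof.
move=> md cd; have [d0 dz ds dt] := md.
have [s sP] := metric_compact_totally_bounded md cd (@ltr01 R).
have [x0|noT] := pselect (exists x0 : T, True); last first.
  by exists 0 => x y; exfalso; apply: noT; exists x.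
case: x0 => x0 _.
have [D DP] : exists D : R, forall z, z \in s -> d x0 z <= D.
  elim: s {sP} => [|a s [D DP]]; first by exists 0.
  exists (Num.max (d x0 a) D) => z; rewrite inE le_max => /orP[/eqP->|/DP->].
    by rewrite lexx.
  by rewrite orbT.
exists (2 * (D + 1)) => x y.
have [z /DP zD zx] := sP x; have [w /DP wD wy] := sP y.
have := dt x x0 y; have := dt x0 z x; have := dt x0 w y; rewrite (ds x x0); lra.
Qed.

Lemma bounded_lipschitz (R : realType) (X Y : choiceType) (dX : X -> X -> R)
    (dY : Y -> Y -> R) (f : X * Y -> R) :
  is_metric dX -> is_metric dY -> metric_compact dX -> metric_compact dY ->
  lipschitz_wrt (prod_dist dX dY) f -> exists M : R, forall z, `|f z| <= M.
Proof.
move=> mX mY cX cY fl.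
have [L L0 fL] := lipschitz_wrt_le (is_metric_prod_dist mX mY) fl.
have [A AP] := metric_compact_bounded mX cX.
have [B BP] := metric_compact_bounded mY cY.
have [z0|noT] := pselect (exists z0 : X * Y, True); last first.
  by exists 0 => x; exfalso; apply: noT; exists x.
case: z0 => z0 _; exists (`|f z0| + L * (A + B)) => z.
have h p q : f p <= f q + L * (A + B).
  by rewrite (le_trans (fL p q))// lerD2l ler_pM2l// lerD.
have := h z z0; have := h z0 z; have := ler_norm (f z0); have := ler_norm (- f z0).
by rewrite normrN; move=> *; rewrite ler_norml; lra.
Qed.

(** Measurability is for the product $\sigma$-algebra, so openness of sets in $X\times Y$ cannot be
    used directly. Freezing the first coordinate at $z$ gives $t_z(x,y)=f(z,y)+L\,d_X(z,x)$, a sum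
    of functions of one coordinate each, with $f\le t_z\le f+2L\,d_X(z,x)$. The minimum of $t_z$
    over a finite net of $X$ is measurable, and it tends to $f$ as the mesh goes to $0$. *)
Lemma measurable_lipschitz_prod (R : realType) (d1 d2 : measure_display)
    (X : measurableType d1) (Y : measurableType d2) (dX : X -> X -> R)
    (dY : Y -> Y -> R) (f : X * Y -> R) :
  is_metric dX -> is_metric dY -> metric_compact dX ->
  borel_for dX -> borel_for dY ->
  lipschitz_wrt (prod_dist dX dY) f -> measurable_fun setT f.
Proof.
move=> mX mY cX bX bY fl; have [dX0 dXz dXs dXt] := mX.
have [_ dYz _ _] := mY.
have [L L0 fL] := lipschitz_wrt_le (is_metric_prod_dist mX mY) fl.
pose t (z : X) (p : X * Y) := f (z, p.2) + L * dX z p.1.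
have tm z : measurable_fun setT (t z).
  apply: measurable_funD.
    apply: (measurableT_comp (f := fun y => f (z, y))) => //.
    apply: (measurable_lipschitz mY bY); apply: (le_lipschitz_wrt mY (L := L)).
    move=> y y'; rewrite (le_trans (fL (z, y) (z, y')))//.
    by rewrite /prod_dist/= (dXz z z).2// add0r.
  apply: measurable_funM => //.
  apply: (measurableT_comp (f := dX z)) => //.
  apply: (measurable_lipschitz mX bX); apply: (le_lipschitz_wrt mX (L := 1)).
  by move=> x x'; rewrite mul1r (dXs x x').
have tf z p : f p <= t z p.
  by have := fL p (z, p.2); rewrite /prod_dist/= (dYz p.2 p.2).2// addr0 dXs.
have ft z p : t z p <= f p + 2 * L * dX z p.1.
  have := fL (z, p.2) p; rewrite /prod_dist/= (dYz p.2 p.2).2// addr0 /t; lra.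
(* The value [t point p] for the empty net is also above [f p], so the lower bound survives this
   extra term. *)
pose h (s : seq X) (p : X * Y) := foldr (fun z m => Num.min (t z p) m) (t point p) s.
have hm s : measurable_fun setT (h s).
  by elim: s => [|z s ih]; [exact: tm|exact: measurable_minr].
have hf s p : f p <= h s p.
  by elim: s => [|z s ih] /=; [exact: tf|rewrite le_min tf].
have ht s z p : z \in s -> h s p <= t z p.
  elim: s => // a s ih; rewrite inE /= ge_min => /orP[/eqP->|/ih->].
    by rewrite lexx.
  by rewrite orbT.
have /choice[s sP] (n : nat) : exists s : seq X,
    forall x, exists2 z, z \in s & dX z x < n.+1%:R^-1.
  by apply: metric_compact_totally_bounded => //; rewrite invr_gt0.
apply: (measurable_fun_cvg (h := fun n => h (s n))) => // p _.
apply: (@squeeze_cvgr _ _ _ _ (fun=> f p) (fun n => f p + 2 * L * n.+1%:R^-1)).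
- near=> n; rewrite hf/=.
  have [z zs zp] := sP n p.1.
  rewrite (le_trans (ht _ _ _ zs))// (le_trans (ft _ _))// lerD2l.
  by rewrite ler_pM2l ?mulr_gt0// ltW.
- exact: cvg_cst.
- rewrite -[X in _ --> X]addr0; apply: cvgD; first exact: cvg_cst.
  rewrite -(mulr0 (2 * L)); apply: cvgM; [exact: cvg_cst|exact: cvg_harmonic].
Unshelve. all: by end_near. Qed.

                                             

(** * Approximation in $L^1$ by Lipschitz functions *)

(** Membership of [h] in the $L^1(\mu)$-closure of the Lipschitz functions. *)
Definition lip_approx (R : realType) (disp : measure_display)
    (T : measurableType disp) (d : T -> T -> R)
    (mu : {measure set T -> \bar R}) (h : T -> R) : Prop :=
  forall e : R, 0 < e -> exists2 g, lipschitz_wrt d g &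
    (\int[mu]_z `|h z - g z|%:E < e%:E)%E.

Lemma lipschitz_wrt_comp_contract (R : realType) (T : Type) (d : T -> T -> R)
    (f : T -> R) (phi : R -> R) :
  (forall a b, `|phi a - phi b| <= `|a - b|) ->
  lipschitz_wrt d f -> lipschitz_wrt d (phi \o f).
Proof. by move=> hphi [L fL]; exists L => p q; exact: le_trans (hphi _ _) (fL p q). Qed.

Lemma lipschitz_wrt_cst (R : realType) (T : Type) (d : T -> T -> R) (a : R) :
  lipschitz_wrt d (fun=> a).
Proof. by exists 0 => p q; rewrite subrr normr0 mul0r. Qed.

Lemma lipschitz_wrtD (R : realType) (T : Type) (d : T -> T -> R) (f g : T -> R) :
  lipschitz_wrt d f -> lipschitz_wrt d g -> lipschitz_wrt d (fun x => f x + g x).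
Proof.
move=> [L fL] [M gM]; exists (L + M) => p q.
by rewrite opprD addrACA (le_trans (ler_normD _ _))// mulrDl lerD.
Qed.

Lemma lipschitz_wrtZ (R : realType) (T : Type) (d : T -> T -> R) (a : R)
    (f : T -> R) :
  lipschitz_wrt d f -> lipschitz_wrt d (fun x => a * f x).
Proof.
move=> [L fL]; exists (`|a| * L) => p q.
by rewrite -mulrBr normrM -mulrA ler_wpM2l.
Qed.

Lemma minr_contract (R : realDomainType) (c a b : R) :
  `|Num.min a c - Num.min b c| <= `|a - b|.
Proof.
wlog ab : a b / a <= b => [h|].
  by have [/h//|/ltW/h] := leP a b; rewrite distrC [leRHS]distrC.
rewrite distrC [leRHS]distrC (ger0_norm (x := b - a)) ?subr_ge0//.
by rewrite /Num.min; case: (ltP a c); case: (ltP b c) => *; rewrite ger0_norm; lra.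
Qed.

Lemma maxr_contract (R : realDomainType) (c a b : R) :
  `|Num.max a c - Num.max b c| <= `|a - b|.
Proof.
wlog ab : a b / a <= b => [h|].
  by have [/h//|/ltW/h] := leP a b; rewrite distrC [leRHS]distrC.
rewrite distrC [leRHS]distrC (ger0_norm (x := b - a)) ?subr_ge0//.
by rewrite /Num.max; case: (ltP a c); case: (ltP b c) => *; rewrite ger0_norm; lra.
Qed.

Lemma integral_normB_triangle (R : realType) (disp : measure_display)
    (T : measurableType disp) (mu : {measure set T -> \bar R}) (f g h : T -> R) :
  measurable_fun setT f -> measurable_fun setT g -> measurable_fun setT h ->
  (\int[mu]_z `|f z - h z|%:E <=
   \int[mu]_z `|f z - g z|%:E + \int[mu]_z `|g z - h z|%:E)%E.
Proof.
move=> mf mg mh.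
have mn (u v : T -> R) : measurable_fun setT u -> measurable_fun setT v ->
    measurable_fun setT (fun z => `|u z - v z|%:E).
  move=> mu' mv; apply/measurable_EFinP; apply: measurableT_comp => //.
  exact: measurable_funB.
rewrite -ge0_integralD//; [|exact: mn|exact: mn].
apply: ge0_le_integral => //; [exact: mn|by apply: emeasurable_funD; exact: mn|].
by move=> x _; rewrite -EFinD lee_fin -[f x - h x](subrKA (g x)) ler_normD.
Qed.

Lemma integrable_bounded (R : realType) (disp : measure_display)
    (T : measurableType disp) (mu : {measure set T -> \bar R}) (f : T -> R) (M : R) :
  (mu setT < +oo)%E -> measurable_fun setT f -> (forall x, `|f x| <= M) ->
  mu.-integrable setT (EFin \o f).
Proof.
move=> muT mf fM; apply: measurable_bounded_integrable => //.
by exists M; split; [exact: num_real|move=> N MN x _; exact: le_trans (fM x) (ltW MN)].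
Qed.

Section lip_approx_closure.
Context (R : realType) (disp : measure_display) (T : measurableType disp)
  (d : T -> T -> R) (mu : {measure set T -> \bar R}).
Hypothesis lm : forall g, lipschitz_wrt d g -> measurable_fun setT g.

Lemma lip_approx_lip (h : T -> R) : lipschitz_wrt d h -> lip_approx d mu h.
Proof.
move=> hl e e0; exists h => //; rewrite integral0_eq ?lte_fin// => x _.
by rewrite subrr normr0.
Qed.

Lemma lip_approx_closed (h : T -> R) : measurable_fun setT h ->
  (forall e : R, 0 < e -> exists k, [/\ measurable_fun setT k, lip_approx d mu k &
     (\int[mu]_z `|h z - k z|%:E < e%:E)%E]) ->
  lip_approx d mu h.
Proof.
move=> mh H e e0; have e20 : 0 < e / 2 by rewrite divr_gt0.
have [k [mk /(_ _ e20)[g gl kg] hk]] := H _ e20; exists g => //.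
apply: (le_lt_trans (integral_normB_triangle mu mh mk (lm gl))).
by rewrite [e in ltRHS]splitr EFinD lteD.
Qed.

Lemma lip_approxD (f g : T -> R) : measurable_fun setT f -> measurable_fun setT g ->
  lip_approx d mu f -> lip_approx d mu g -> lip_approx d mu (fun x => f x + g x).
Proof.
move=> mf mg af ag e e0; have e20 : 0 < e / 2 by rewrite divr_gt0.
have [u ul fu] := af _ e20; have [v vl gv] := ag _ e20.
exists (fun x => u x + v x); first exact: lipschitz_wrtD.
have mu' := lm ul; have mv := lm vl.
apply: (le_lt_trans (y := (\int[mu]_z `|(f z + g z) - (u z + g z)|%:E +
    \int[mu]_z `|(u z + g z) - (u z + v z)|%:E)%E)).
  by apply: (integral_normB_triangle mu (g := fun z => u z + g z));
    exact: measurable_funD.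
under eq_integral do rewrite opprD addrACA subrr addr0.
under [X in (_ + X)%E]eq_integral do rewrite opprD addrACA subrr add0r.
by rewrite [e in ltRHS]splitr EFinD lteD.
Qed.

(** A contraction keeps Lipschitz functions Lipschitz and does not increase $L^1$ distances. It is
    applied to $t\mapsto\min(t,1)$, to pass from sums of indicators to unions. *)
Lemma lip_approx_contract (f : T -> R) (phi : R -> R) :
  measurable_fun setT f -> (forall a b, `|phi a - phi b| <= `|a - b|) ->
  measurable_fun setT phi ->
  lip_approx d mu f -> lip_approx d mu (phi \o f).
Proof.
move=> mf hphi mphi af e /af[g gl fg].
have gl' := lipschitz_wrt_comp_contract hphi gl.
exists (phi \o g) => //; apply: le_lt_trans fg.
apply: ge0_le_integral => //.
- apply/measurable_EFinP; apply: measurableT_comp => //.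
  by apply: measurable_funB; [exact: measurableT_comp|exact: lm].
- apply/measurable_EFinP; apply: measurableT_comp => //.
  by apply: measurable_funB; [|exact: lm].
- by move=> x _; rewrite lee_fin hphi.
Qed.

Lemma lip_approxZ (a : R) (f : T -> R) : measurable_fun setT f ->
  lip_approx d mu f -> lip_approx d mu (fun x => a * f x).
Proof.
move=> mf af e e0; have a0 : 0 < `|a| + 1 by rewrite ltr_wpDl.
have [g gl fg] := af _ (divr_gt0 e0 a0).
exists (fun x => a * g x); first exact: lipschitz_wrtZ.
have mfg : measurable_fun setT (fun z => `|f z - g z|%:E).
  apply/measurable_EFinP; apply: measurableT_comp => //.
  by apply: measurable_funB => //; exact: lm.
apply: (le_lt_trans (y := ((`|a| + 1)%:E * \int[mu]_z `|f z - g z|%:E)%E)).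
  rewrite -ge0_integralZl ?lee_fin ?(ltW a0)//.
  apply: ge0_le_integral => //.
  - apply/measurable_EFinP; apply: measurableT_comp => //.
    by apply: measurable_funB; apply: measurable_funM => //; exact: lm.
  - exact: emeasurable_funM.
  - by move=> x _; rewrite -EFinM lee_fin -mulrBr normrM ler_wpM2r// lerDl.
by rewrite muleC -lte_pdivlMr.
Qed.

Lemma lip_approx_cvg (f : nat -> T -> R) (h : T -> R) (M : R) :
  (mu setT < +oo)%E ->
  (forall n, measurable_fun setT (f n)) -> (forall n, lip_approx d mu (f n)) ->
  (forall n x, `|f n x| <= M) ->
  (forall x, f n x @[n --> \oo] --> h x) -> lip_approx d mu h.
Proof.
move=> muT mf af fM fh.
have mh : measurable_fun setT h by apply: measurable_fun_cvg => // x _; exact: fh.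
apply: lip_approx_closed => // e e0.
have [] := @dominated_convergence _ _ _ mu _ measurableT (fun n => EFin \o f n)
  (EFin \o h) (cst M%:E).
- by move=> n; exact/measurable_EFinP.
- exact/measurable_EFinP.
- by apply: aeW => x _; apply: cvg_EFin; [exact: nearW|exact: fh].
- exact: (integrable_bounded (f := cst M) (M := `|M|)).
- by apply: aeW => x n _; rewrite /= lee_fin fM.
(* Of the conclusions of dominated convergence, the one kept is $\int|f_n-h|\,d\mu\to0$. *)
move=> _ /(_ _ (nbhs_open_ereal_lt (f := fun=> e) e0))[n _ /(_ n (leqnn n))/= hn] _.
exists (f n); split => //; apply: le_lt_trans hn.
by under eq_integral do rewrite distrC.
Qed.

Hypothesis muT : (mu setT < +oo)%E.

(** Complements come from $1-1_A$, finite unions from truncated sums, and countable unions from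
    dominated convergence along the partial unions. The class is thus a $\sigma$-algebra outright,
    and it is enough to test it on generators. *)
Lemma sigma_algebra_lip_approx :
  sigma_algebra setT [set A | measurable A /\ lip_approx d mu \1_A].
Proof.
have U A B : measurable A /\ lip_approx d mu \1_A ->
    measurable B /\ lip_approx d mu \1_B ->
    measurable (A `|` B) /\ lip_approx d mu \1_(A `|` B).
  move=> [mA aA] [mB aB]; split; first exact: measurableU.
  (* $1_{A\cup B}=\min(1_A+1_B,1)$. *)
  rewrite (_ : \1_(A `|` B) = (fun t => Num.min t 1) \o (fun x => \1_A x + \1_B x)).
    apply: lip_approx_contract.
    - by apply: measurable_funD; exact: measurable_indic.
    - exact: minr_contract.
    - exact: measurable_minr.
    - by apply: lip_approxD => //; exact: measurable_indic.
  apply/funext => x; rewrite /= !indicE in_setU.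
  case: (x \in A); case: (x \in B) => /=.
  - by rewrite min_r// lerDl.
  - by rewrite addr0 minxx.
  - by rewrite add0r minxx.
  - by rewrite addr0 min_l.
split.
- by split => //; rewrite indic0; apply: lip_approx_lip; exact: lipschitz_wrt_cst.
- move=> A [mA aA]; rewrite setTD; split; first exact: measurableC.
  rewrite (_ : \1_(~` A) = (fun x => 1 + (-1) * \1_A x)).
    apply: lip_approxD => //.
    - by apply: measurable_funM => //; exact: measurable_indic.
    - by apply: lip_approx_lip; exact: lipschitz_wrt_cst.
    - by apply: lip_approxZ => //; exact: measurable_indic.
  by apply/funext => x; rewrite indicC indicE; case: (x \in A) => /=; lra.
- move=> A hA; split; first by apply: bigcup_measurable => k _; exact: (hA k).1.
  have hB n : measurable (\big[setU/set0]_(i < n) A i) /\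
      lip_approx d mu \1_(\big[setU/set0]_(i < n) A i).
    elim: n => [|n ih]; last by rewrite big_ord_recr/=; exact: (U _ _ ih (hA n)).
    rewrite big_ord0 indic0; split => //.
    by apply: lip_approx_lip; exact: lipschitz_wrt_cst.
  apply: (lip_approx_cvg (f := fun n => \1_(\big[setU/set0]_(i < n) A i)) (M := 1)) => //.
  + by move=> n; apply: measurable_indic; exact: (hB n).1.
  + by move=> n; exact: (hB n).2.
  + by move=> n x; rewrite indicE; case: (_ \in _); rewrite ?normr1 ?normr0.
  (* At each point the indicators of the partial unions are eventually constant: equal to $1$ once
     some $A_i$ containing $x$ has been included, and always $0$ if there is none. *)
  + move=> x; have [[i _ Aix]|nAx] := pselect ((\bigcup_k A k) x).
      apply: cvg_near_cst; exists i.+1 => // n /= ni.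
      rewrite !indicE !mem_set//; first by exists i.
      by rewrite -bigcup_mkord; exists i.
    apply: cvg_near_cst; apply: nearW => n.
    rewrite !indicE !memNset// -bigcup_mkord => -[i _ Aix]; apply: nAx.
    by exists i.
Qed.

Hypothesis am : forall A, measurable A -> lip_approx d mu \1_A.

Import HBSimple.

(** A bounded function is integrable for the finite measure [mu], hence an $L^1$ limit of simple
    functions; these are finite combinations of indicators, which [am] handles. *)
Lemma lip_approx_bounded (h : T -> R) (M : R) :
  measurable_fun setT h -> (forall x, `|h x| <= M) -> lip_approx d mu h.
Proof.
move=> mh hM.
have ih : mu.-integrable setT (EFin \o h) by exact: (integrable_bounded (M := M)).
apply: lip_approx_closed => // e e0.
have [g [ig _]] := approximation_sfun_integrable measurableT ih.
move=> /(_ _ (nbhs_open_ereal_lt (f := fun=> e) e0))[n _ /(_ n (leqnn n))/= hn].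
exists (g n); split => //.
pose S := finmap.enum_fset (fset_set (range (g n))).
have mS y : measurable (g n @^-1` [set y]) by exact: measurable_sfunP.
rewrite (_ : (g n : T -> R) = fun x => \sum_(y <- S) y * \1_(g n @^-1` [set y]) x).
  elim: S => [|y S ihS].
    under eq_fun do rewrite big_nil.
    by apply: lip_approx_lip; exact: lipschitz_wrt_cst.
  under eq_fun do rewrite big_cons.
  apply: lip_approxD => //.
  - by apply: measurable_funM => //; exact: measurable_indic.
  - by apply: measurable_sum => z; exact: measurable_funM.
  - by apply: lip_approxZ; [exact: measurable_indic|exact: am].
by apply/funext => x; rewrite fimfunE fsbig_finite.
Qed.

End lip_approx_closure.

                                                     
                                         
(** * Indicators of open sets and of measurable subsets of the product *)

Lemma metric_open_indic_cvg (R : realType) (T : Type) (d : T -> T -> R) (U : set T) :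
  is_metric d -> metric_open d U ->
  exists g : nat -> T -> R, [/\ forall n, lipschitz_wrt d (g n),
    forall n x, 0 <= g n x <= 1 & forall x, g n x @[n --> \oo] --> (\1_U x : R)].
Proof.
move=> md oU; have [d0 dz ds dt] := md.
(* The inf-convolution of $1_U$ with $n\,d$: an $n$-Lipschitz function lying between $0$ and
   $1_U$. *)
pose g (n : nat) x : R := inf [set \1_U z + n%:R * d x z | z in [set: T]].
have i0 z : 0 <= \1_U z :> R by rewrite indicE.
have i1 z : \1_U z <= 1 :> R by rewrite indicE; case: (_ \in _); rewrite ?ler01.
have gle n x z : g n x <= \1_U z + n%:R * d x z.
  apply: ge_inf; last by exists z.
  by exists 0 => _ [w _ <-]; rewrite addr_ge0// mulr_ge0.
have leg n x b : (forall z, b <= \1_U z + n%:R * d x z) -> b <= g n x.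
  move=> hb; apply: lb_le_inf; first by exists (\1_U x + n%:R * d x x); exists x.
  by move=> _ [z _ <-].
have gU n x : g n x <= \1_U x.
  by have := gle n x x; rewrite (dz x x).2// mulr0 addr0.
have g0 n x : 0 <= g n x by apply: leg => z; rewrite addr_ge0// mulr_ge0.
exists g; split.
- move=> n; apply: (le_lipschitz_wrt md (L := n%:R)) => x y.
  rewrite -lerBlDr; apply: leg => z; rewrite lerBlDr (le_trans (gle n x z))//.
  by rewrite -addrA lerD2l -mulrDr ler_wpM2l// addrC dt.
- by move=> n x; rewrite g0 (le_trans (gU n x)).
move=> x; have [Ux|nUx] := pselect (U x); last first.
  apply: cvg_near_cst; apply: nearW => n; apply/eqP; rewrite eq_le gU/=.
  by rewrite indicE memNset.
have [r r0 rU] := oU x Ux.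
(* If the ball of radius $r$ around $x$ lies in $U$, points outside $U$ cost at least $nr$, so
   $g_n(x)=1$ as soon as $n\ge 1/r$. *)
apply: cvg_near_cst; near=> n; apply/eqP; rewrite eq_le gU/= indicE mem_set//.
apply: leg => z; have [Uz|nUz] := pselect (U z).
  by rewrite indicE mem_set// lerDl mulr_ge0.
rewrite indicE memNset// add0r.
have rz : r <= d x z by rewrite leNgt; apply/negP => /rU.
rewrite (@le_trans _ _ (n%:R * r))// ?ler_wpM2l// -ler_pdivrMr// div1r.
by near: n; exact: nbhs_infty_ger.
Unshelve. all: by end_near. Qed.

Lemma lipschitz_wrt_fst (R : realType) (X Y : Type) (dX : X -> X -> R)
    (dY : Y -> Y -> R) (f : X -> R) : is_metric dX -> is_metric dY ->
  lipschitz_wrt dX f -> lipschitz_wrt (prod_dist dX dY) (fun z => f z.1).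
Proof.
move=> mX mY /(lipschitz_wrt_le mX)[L L0 fL].
apply: (le_lipschitz_wrt (is_metric_prod_dist mX mY) (L := L)) => p q.
rewrite (le_trans (fL _ q.1))// lerD2l ler_pM2l// lerDl.
by have [-> ] := mY.
Qed.

Lemma lipschitz_wrt_snd (R : realType) (X Y : Type) (dX : X -> X -> R)
    (dY : Y -> Y -> R) (f : Y -> R) : is_metric dX -> is_metric dY ->
  lipschitz_wrt dY f -> lipschitz_wrt (prod_dist dX dY) (fun z => f z.2).
Proof.
move=> mX mY /(lipschitz_wrt_le mY)[L L0 fL].
apply: (le_lipschitz_wrt (is_metric_prod_dist mX mY) (L := L)) => p q.
rewrite (le_trans (fL _ q.2))// lerD2l ler_pM2l// lerDr.
by have [-> ] := mX.
Qed.

Lemma lip_approx_indic_prod (R : realType) (d1 d2 : measure_display)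
    (X : measurableType d1) (Y : measurableType d2) (dX : X -> X -> R)
    (dY : Y -> Y -> R) (mu : {measure set (X * Y) -> \bar R}) (A : set (X * Y)) :
  is_metric dX -> is_metric dY -> metric_compact dX ->
  borel_for dX -> borel_for dY -> (mu setT < +oo)%E ->
  measurable A -> lip_approx (prod_dist dX dY) mu \1_A.
Proof.
move=> mX mY cX bX bY muT mA.
have lm (g : X * Y -> R) : lipschitz_wrt (prod_dist dX dY) g -> measurable_fun setT g.
  exact: measurable_lipschitz_prod.
have sG := sigma_algebra_lip_approx lm muT.
pose G := [set A : set (X * Y) | measurable A /\ lip_approx (prod_dist dX dY) mu \1_A].
suff /(_ A mA)[] : measurable `<=` G by [].
have lcvg (V : set (X * Y)) (g : nat -> X * Y -> R) :
    (forall n, lipschitz_wrt (prod_dist dX dY) (g n)) ->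
    (forall n x, 0 <= g n x <= 1) ->
    (forall x, g n x @[n --> \oo] --> (\1_V x : R)) ->
    lip_approx (prod_dist dX dY) mu \1_V.
  move=> gl g01 gV; apply: (lip_approx_cvg lm (f := g) (M := 1)) => //.
  - by move=> n; exact: lm.
  - by move=> n; exact: lip_approx_lip.
  - by move=> n x; have /andP[? ?] := g01 n x; rewrite ger0_norm.
(* The product $\sigma$-algebra is generated by the cylinders over each factor. The sets whose
   cylinder lies in [G] form a $\sigma$-algebra on that factor, so only cylinders over open sets
   remain to be checked. *)
apply: smallest_sub => //; rewrite subUset; split => _ [U mU <-].
- suff : d1.-measurable `<=` image_set_system setT (@fst X Y) G by move=> /(_ _ mU).
  rewrite bX; apply: smallest_sub; first exact: sigma_algebra_image.
  move=> {mU}U oU; rewrite /image_set_system/= setTI; split.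
    rewrite -[X in measurable X]setTI; apply: measurable_fst => //.
    exact: measurable_metric_open bX oU.
  have [g [gl g01 gU]] := metric_open_indic_cvg mX oU.
  by apply: (lcvg _ (fun n z => g n z.1)) => // n; exact: lipschitz_wrt_fst.
- suff : d2.-measurable `<=` image_set_system setT (@snd X Y) G by move=> /(_ _ mU).
  rewrite bY; apply: smallest_sub; first exact: sigma_algebra_image.
  move=> {mU}U oU; rewrite /image_set_system/= setTI; split.
    rewrite -[X in measurable X]setTI; apply: measurable_snd => //.
    exact: measurable_metric_open bY oU.
  have [g [gl g01 gU]] := metric_open_indic_cvg mY oU.
  by apply: (lcvg _ (fun n z => g n z.2)) => // n; exact: lipschitz_wrt_snd.
Qed.

                      

(** * Normalization of a Lipschitz function and its cost *)

Lemma EFin_Rintegral (R : realType) (disp : measure_display)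
    (T : measurableType disp) (mu : {measure set T -> \bar R}) (f : T -> R) :
  mu.-integrable setT (EFin \o f) ->
  (\int[mu]_x (f x)%:E)%E = (\int[mu]_x f x)%:E.
Proof. by move=> fi; rewrite /Rintegral fineK//; exact: integrable_fin_num fi. Qed.

Lemma Rintegral_probability_cst (R : realType) (disp : measure_display)
    (T : measurableType disp) (P : probability T R) (a : R) :
  \int[P]_x a = a.
Proof.
rewrite Rintegral_cst// [X in fine X](_ : _ = 1%E) ?mulr1//.
exact: probability_setT.
Qed.

Lemma expR_norm_le (R : realType) (t M : R) : `|t| <= M -> `|expR t| <= expR M.
Proof. by move=> tM; rewrite ger0_norm ?expR_ge0// ler_expR (le_trans (ler_norm _)). Qed.

HB.instance Definition _ (d1 d2 : measure_display) (X : measurableType d1)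
  (Y : measurableType d2) := isMeasurableFun.Build _ _ _ _ (@snd X Y) measurable_snd.

(** The measure $\rho=\nu\otimes\pi_Y$, where $\pi_Y$ is the image of $\pi$ under the second
    projection. *)
Definition prod_marginal (R : realType) (d1 d2 : measure_display)
    (X : measurableType d1) (Y : measurableType d2) (nu : probability X R)
    (pi : probability (X * Y)%type R) : {measure set (X * Y)%type -> \bar R} :=
  (nu \x distribution pi (snd : {mfun (X * Y)%type >-> Y}))%E.

Lemma prod_marginal_lty (R : realType) (d1 d2 : measure_display)
    (X : measurableType d1) (Y : measurableType d2) (nu : probability X R)
    (pi : probability (X * Y)%type R) : (prod_marginal nu pi setT < +oo)%E.
Proof.
rewrite -setXTT.
have := product_measure1E nu (distribution pi (snd : {mfun (X * Y)%type >-> Y}))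
  (@measurableT _ X) (@measurableT _ Y).
rewrite [X in (X * _)%E](_ : _ = 1%E); last exact: probability_setT.
rewrite [X in (_ * X)%E](_ : _ = 1%E); last exact: probability_setT.
by rewrite mule1 /prod_marginal /= => ->; rewrite ltry.
Qed.

Lemma integral_prod_marginal (R : realType) (d1 d2 : measure_display)
    (X : measurableType d1) (Y : measurableType d2) (nu : probability X R)
    (pi : probability (X * Y)%type R) (h : X * Y -> R) :
  measurable_fun setT h -> (forall z, 0 <= h z) ->
  (\int[prod_marginal nu pi]_z (h z)%:E =
   \int[pi]_z \int[nu]_x (h (x, z.2))%:E)%E.
Proof.
move=> mh h0; have /measurable_EFinP mh' := mh.
rewrite /prod_marginal (fubini_tonelli2 (EFin \o h))//.
rewrite ge0_integral_distribution//.
- exact: measurable_fun_fubini_tonelli_G.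
- by move=> y; apply: integral_ge0 => x _; rewrite lee_fin h0.
Qed.

(** The witness is $f(x,y)=g(x,y)-\ln A(y)$ with $A(y)=\int e^{g(x,y)}\,d\nu(x)$. Its integral falls
    short of that of $g$ by $\int\ln A\,d\pi\le\int A\,d\pi-1$, and $\int A\,d\pi=\int e^g\,d\rho$
    by Tonelli. The bound is no longer in terms of $f$ and is stable under perturbation of $g$. *)
Lemma exists_normalized_lipschitz (R : realType) (d1 d2 : measure_display)
    (X : measurableType d1) (Y : measurableType d2)
    (dX : X -> X -> R) (dY : Y -> Y -> R)
    (nu : probability X R) (pi : probability (X * Y)%type R) (g : X * Y -> R) :
  is_metric dX -> is_metric dY -> metric_compact dX -> metric_compact dY ->
  borel_for dX -> borel_for dY -> lipschitz_wrt (prod_dist dX dY) g ->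
  exists f, [/\ lipschitz_wrt (prod_dist dX dY) f, nu_normalized nu f &
    \int[pi]_z g z - \int[prod_marginal nu pi]_z expR (g z) + 1
      <= \int[pi]_z f z].
Proof.
move=> mX mY cX cY bX bY gl.
have [_ dXz _ _] := mX; have [dY0 _ dYs _] := mY.
have [M gM] := bounded_lipschitz mX mY cX cY gl.
have [L L0 gL] := lipschitz_wrt_le (is_metric_prod_dist mX mY) gl.
have lm (h : X * Y -> R) : lipschitz_wrt (prod_dist dX dY) h -> measurable_fun setT h.
  exact: measurable_lipschitz_prod.
have pT : (pi setT < +oo)%E by rewrite probability_setT ltry.
have nT : (nu setT < +oo)%E by rewrite probability_setT ltry.
have mg := lm _ gl.
have meg : measurable_fun setT (fun z => expR (g z)) by exact: measurableT_comp.
have ieg y : nu.-integrable setT (EFin \o (fun x => expR (g (x, y)))).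
  apply: (integrable_bounded (M := expR M)) => //.
    exact: (measurableT_comp (f := fun z => expR (g z))).
  by move=> x; exact: expR_norm_le.
pose A y := \int[nu]_x expR (g (x, y)).
have AE y : (\int[nu]_x (expR (g (x, y)))%:E = (A y)%:E)%E by exact: EFin_Rintegral.
have leA y (a : R) : (forall x, a <= expR (g (x, y))) -> a <= A y.
  move=> ha; rewrite -[leLHS](Rintegral_probability_cst nu); apply: le_Rintegral => //.
  by apply: (integrable_bounded (M := `|a|)).
have A0 y : 0 < A y.
  rewrite (lt_le_trans (expR_gt0 (- M)))//; apply: leA => x.
  by rewrite ler_expR lerNl (le_trans _ (gM (x, y)))// -normrN ler_norm.
have AL y y' : ln (A y) <= ln (A y') + L * dY y y'.
  (* After exponentiation the claim is $A(y)\le e^{L\,d_Y(y,y')}A(y')$, which is the integral over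
     $x$ of the Lipschitz bound on $g$. *)
  rewrite -[leRHS]expRK expRD lnK ?posrE// ler_ln ?posrE ?mulr_gt0 ?expR_gt0//.
  rewrite mulrC -RintegralZl//; apply: le_Rintegral => //.
    apply: (integrable_bounded (M := expR (L * dY y y') * expR M)) => //.
      apply: measurable_funM => //.
      exact: (measurableT_comp (f := fun z => expR (g z))).
    by move=> x; rewrite normrM ler_pM// expR_norm_le// ger0_norm// mulr_ge0// ?ltW.
  move=> x _; rewrite -expRD ler_expR addrC.
  by have := gL (x, y) (x, y'); rewrite /prod_dist/= (dXz x x).2// add0r.
pose f z := g z + -1 * ln (A z.2).
have fl : lipschitz_wrt (prod_dist dX dY) f.
  apply: lipschitz_wrtD => //; apply: lipschitz_wrtZ.
  apply: (lipschitz_wrt_snd (f := fun y => ln (A y))) => //.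
  exact: (le_lipschitz_wrt mY AL).
have [N fN] := bounded_lipschitz mX mY cX cY fl.
have mf := lm _ fl.
have Ef z : A z.2 = expR (g z - f z).
  by rewrite /f mulN1r subKr lnK ?posrE.
exists f; split => //.
  move=> y; rewrite /f/=.
  under eq_integral do rewrite mulN1r expRD expRN lnK ?posrE// EFinM.
  rewrite integralZr//; last exact: ieg.
  by rewrite AE -EFinM divff// gt_eqF.
have iA : pi.-integrable setT (EFin \o (fun z => A z.2)).
  rewrite (_ : (fun z => A z.2) = (fun z => expR (g z - f z))); last exact/funext.
  apply: (integrable_bounded (M := expR (M + N))) => //.
    by apply: measurableT_comp => //; exact: measurable_funB.
  by move=> z; rewrite expR_norm_le// (le_trans (ler_normB _ _))// lerD.
have ig : pi.-integrable setT (EFin \o g) by exact: (integrable_bounded (M := M)).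
have if' : pi.-integrable setT (EFin \o f) by exact: (integrable_bounded (M := N)).
have i1 : pi.-integrable setT (EFin \o (fun=> 1)).
  by apply: (integrable_bounded (M := `|1|)).
have -> : \int[prod_marginal nu pi]_z expR (g z) = \int[pi]_z A z.2.
  rewrite /Rintegral integral_prod_marginal//.
  by congr fine; apply: eq_integral => z _; exact: AE.
have igA : pi.-integrable setT (EFin \o (fun z => g z - A z.2)).
  exact: (integrableB measurableT ig iA).
rewrite -[X in _ - _ + X](Rintegral_probability_cst pi) -RintegralB// -RintegralD//.
apply: le_Rintegral => //; first exact: (integrableD measurableT igA i1).
(* Pointwise the claim is $1+t\le e^t$ at $t=g-f=\ln A$. *)
move=> z _; rewrite Ef.
by have := expR_ge1Dx (g z - f z); lra.
Qed.

(** * From bounded measurable functions to normalized Lipschitz ones *)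

Lemma expR_lipschitz (R : realType) (a b M : R) : a <= M -> b <= M ->
  `|expR a - expR b| <= expR M * `|a - b|.
Proof.
wlog ab : a b / b <= a => [h aM bM|aM _].
  have [/h|/ltW/h] := leP b a; first exact.
  by rewrite distrC (distrC a); apply.
rewrite !ger0_norm ?subr_ge0 ?ler_expR//.
apply: (@le_trans _ _ (expR a * (a - b))); last first.
  by rewrite ler_wpM2r ?subr_ge0// ler_expR.
have -> : expR b = expR a * expR (b - a) by rewrite -expRD addrC subrK.
rewrite -{1}[expR a]mulr1 -mulrBr ler_wpM2l ?expR_ge0//.
by have := expR_ge1Dx (b - a); lra.
Qed.

Lemma Rintegral_norm_le (R : realType) (disp : measure_display)
    (T : measurableType disp) (mu : {measure set T -> \bar R}) (f g : T -> R) (e : R) :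
  mu.-integrable setT (EFin \o f) -> mu.-integrable setT (EFin \o g) ->
  (\int[mu]_z `|f z - g z|%:E < e%:E)%E ->
  \int[mu]_z `|f z - g z| <= e.
Proof.
move=> fi gi h; have fgi : mu.-integrable setT (EFin \o (fun z => `|f z - g z|)).
  by have := integrable_abse (integrableB measurableT fi gi).
by rewrite -lee_fin -EFin_Rintegral// ltW.
Qed.

(** The penalized functional $\int b\,d\pi-\int e^b\,d\rho+1$ changes little when [b] is replaced by
    a Lipschitz function that is $L^1$-close and has the same bound, since $\exp$ is $e^M$-Lipschitz
    on $(-\infty,M]$. *)
Lemma normalized_lipschitz_bounded (R : realType) (d1 d2 : measure_display)
    (X : measurableType d1) (Y : measurableType d2)
    (dX : X -> X -> R) (dY : Y -> Y -> R)
    (nu : probability X R) (pi : probability (X * Y)%type R) (b : X * Y -> R)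
    (M e : R) :
  is_metric dX -> is_metric dY -> metric_compact dX -> metric_compact dY ->
  borel_for dX -> borel_for dY ->
  measurable_fun setT b -> (forall z, `|b z| <= M) -> 0 < e ->
  exists f, [/\ lipschitz_wrt (prod_dist dX dY) f, nu_normalized nu f &
    \int[pi]_z b z - \int[prod_marginal nu pi]_z expR (b z) + 1 - e
      <= \int[pi]_z f z].
Proof.
move=> mX mY cX cY bX bY mb bM e0.
set rho := prod_marginal nu pi.
have pT : (pi setT < +oo)%E by rewrite probability_setT ltry.
have rT : (rho setT < +oo)%E by exact: prod_marginal_lty.
have lm (h : X * Y -> R) : lipschitz_wrt (prod_dist dX dY) h -> measurable_fun setT h.
  exact: measurable_lipschitz_prod.
(* Approximating for the sum of the two measures gives one function that is close to [b] for
   both. *)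
pose mu := measure_add pi rho.
have muT : (mu setT < +oo)%E by rewrite /mu measure_addE lte_add_pinfty.
(* With tolerance $\delta=e/(1+e^M)$, the linear term costs $\delta$ and the exponential term
   $e^M\delta$, in total $e$. *)
have e1 : 0 < e / (1 + expR M) by rewrite divr_gt0// addr_gt0// expR_gt0.
have amu := lip_approx_bounded lm muT
  (fun A => lip_approx_indic_prod mX mY cX bX bY muT) mb bM.
have [g0 gl0 bg0] := amu _ e1.
(* Clamping to $[-M,M]$ is a contraction that fixes [b], so it brings [g0] no farther from [b] and
   provides the bound needed to control the exponentials. *)
pose g := (fun t => Num.max t (- M)) \o ((fun t => Num.min t M) \o g0).
have M0 : 0 <= M by exact: le_trans (normr_ge0 _) (bM point).
have gl : lipschitz_wrt (prod_dist dX dY) g.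
  apply: lipschitz_wrt_comp_contract; first exact: maxr_contract.
  by apply: lipschitz_wrt_comp_contract => //; exact: minr_contract.
have gM z : `|g z| <= M.
  by rewrite ler_norml /g/= le_max lexx orbT/= ge_max ge_min lexx orbT/=; lra.
have mg := lm _ gl.
have bg z : `|b z - g z| <= `|b z - g0 z|.
  have bE : b z = Num.max (Num.min (b z) M) (- M).
    have := bM z; rewrite ler_norml => /andP[b1 b2].
    by rewrite min_l// max_l.
  rewrite bE /g/=; apply: le_trans (maxr_contract _ _ _) _.
  by rewrite -bE; exact: minr_contract.
have mn (h : X * Y -> R) : measurable_fun setT h ->
    measurable_fun setT (fun z => `|b z - h z|%:E).
  move=> mh; apply/measurable_EFinP; apply: measurableT_comp => //.
  exact: measurable_funB.
have : (\int[mu]_z `|b z - g z|%:E < (e / (1 + expR M))%:E)%E.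
  apply: le_lt_trans bg0; apply: ge0_le_integral => //.
  - exact: mn.
  - by apply: mn; exact: lm.
  - by move=> z _; rewrite lee_fin.
rewrite ge0_integral_measure_add//; last exact: mn.
move=> hmu.
have i0 (m : {measure set (X * Y) -> \bar R}) : (0 <= \int[m]_z `|b z - g z|%:E)%E.
  by apply: integral_ge0 => z _; rewrite lee_fin.
have ib (m : {measure set (X * Y) -> \bar R}) : (m setT < +oo)%E ->
    m.-integrable setT (EFin \o b) by move=> mT; exact: (integrable_bounded (M := M)).
have ig (m : {measure set (X * Y) -> \bar R}) : (m setT < +oo)%E ->
    m.-integrable setT (EFin \o g) by move=> mT; exact: (integrable_bounded (M := M)).
have hpi : \int[pi]_z `|b z - g z| <= e / (1 + expR M).
  apply: Rintegral_norm_le; [exact: ib|exact: ig|].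
  by apply: le_lt_trans hmu; rewrite leeDl.
have hrho : \int[rho]_z `|b z - g z| <= e / (1 + expR M).
  apply: Rintegral_norm_le; [exact: ib|exact: ig|].
  by apply: le_lt_trans hmu; rewrite leeDr.
have [f [fl fn ff]] := exists_normalized_lipschitz nu pi mX mY cX cY bX bY gl.
exists f; split => //; apply: le_trans ff.
have h1 : \int[pi]_z b z - \int[pi]_z g z <= e / (1 + expR M).
  rewrite -RintegralB//; [|exact: ib|exact: ig].
  apply: le_trans hpi; apply: le_trans (ler_norm _) _.
  by apply: le_normr_Rintegral => //;
    exact: (integrableB measurableT (ib _ pT) (ig _ pT)).
have ieb : rho.-integrable setT (EFin \o (fun z => expR (b z))).
  apply: (integrable_bounded (M := expR M)) => //; first exact: measurableT_comp.
  by move=> z; exact: expR_norm_le.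
have ieg : rho.-integrable setT (EFin \o (fun z => expR (g z))).
  apply: (integrable_bounded (M := expR M)) => //; first exact: measurableT_comp.
  by move=> z; exact: expR_norm_le.
have h2 : \int[rho]_z expR (g z) - \int[rho]_z expR (b z)
    <= expR M * (e / (1 + expR M)).
  rewrite -RintegralB//.
  apply: (@le_trans _ _ (expR M * \int[rho]_z `|b z - g z|)); last first.
    by rewrite ler_wpM2l ?expR_ge0.
  have ia : rho.-integrable setT (EFin \o (fun z => `|b z - g z|)).
    by have := integrable_abse (integrableB measurableT (ib _ rT) (ig _ rT)).
  rewrite -RintegralZl//; apply: le_Rintegral => //.
  - exact: (integrableB measurableT ieg ieb).
  - exact: (integrableZl measurableT (expR M) ia).
  - move=> z _; rewrite (le_trans (ler_norm _))// distrC expR_lipschitz//.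
      by rewrite (le_trans (ler_norm _)).
    by rewrite (le_trans (ler_norm _)).
have : e / (1 + expR M) + expR M * (e / (1 + expR M)) = e.
  rewrite -{1}[e / _]mul1r -mulrDl mulrC divfK// gt_eqF// addr_gt0// expR_gt0.
lra.
Qed.

(** * Truncation of an arbitrary admissible function *)

Lemma integral_min_posr (R : realType) (disp : measure_display)
    (T : measurableType disp) (mu : {measure set T -> \bar R}) (c : T -> R)
    (x : \bar R) : measurable_fun setT c ->
  (forall n : nat, \int[mu]_z (Num.min (Num.max (c z) 0) n%:R)%:E <= x)%E ->
  (\int[mu]_z (Num.max (c z) 0)%:E <= x)%E.
Proof.
move=> mc hx; pose u (n : nat) z := (Num.min (Num.max (c z) 0) n%:R)%:E.
have mu' n : measurable_fun setT (u n).
  apply/measurable_EFinP; apply: measurable_minr => //; exact: measurable_maxr.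
have u0 n z : (0 <= u n z)%E by rewrite lee_fin le_min le_max lexx orbT ler0n.
have uh z : {homo u^~ z : n m / (n <= m)%N >-> (n <= m)%E}.
  move=> n m nm; rewrite lee_fin le_min !ge_min lexx/=.
  by apply/orP; right; rewrite ler_nat.
have ucvg z : limn (u ^~ z) = (Num.max (c z) 0)%:E.
  apply/cvg_lim => //; apply: cvg_near_cst; near=> n; congr EFin.
  by rewrite min_l//; near: n; exact: nbhs_infty_ger.
under eq_integral do rewrite -ucvg.
rewrite monotone_convergence//; apply: lime_le; last by apply: nearW => n; exact: hx.
apply: ereal_nondecreasing_is_cvgn => n m nm.
by apply: ge0_le_integral => // z _; exact: uh.
Unshelve. all: by end_near. Qed.

(** Writing $c=c^+-c^-$, it suffices to bound $\int\min(c^+,n)\,d\pi$ by $S+\int c^-\,d\pi+e$ for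
    all $n$ and $e>0$. This follows by applying the bounded case to a two-sided truncation of [c],
    whose normalization defect is at most $e/2$. *)
Lemma le_Hnu_lipschitz (R : realType) (d1 d2 : measure_display)
    (X : measurableType d1) (Y : measurableType d2)
    (dX : X -> X -> R) (dY : Y -> Y -> R)
    (nu : probability X R) (pi : probability (X * Y)%type R) (c : X * Y -> R)
    (S : \bar R) :
  is_metric dX -> is_metric dY -> metric_compact dX -> metric_compact dY ->
  borel_for dX -> borel_for dY ->
  measurable_fun setT c -> integral_defined pi c -> nu_normalized nu c ->
  (forall f, lipschitz_wrt (prod_dist dX dY) f -> nu_normalized nu f ->
    (\int[pi]_z (f z)%:E <= S)%E) ->
  (\int[pi]_z (c z)%:E <= S)%E.
Proof.
move=> mX mY cX cY bX bY mc ic cn hS.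
have pT : (pi setT < +oo)%E by rewrite probability_setT ltry.
have nT : (nu setT < +oo)%E by rewrite probability_setT ltry.
set rho := prod_marginal nu pi.
have rT : (rho setT < +oo)%E by exact: prod_marginal_lty.
have -> : (\int[pi]_z (c z)%:E = \int[pi]_z (Num.max (c z) 0)%:E -
    \int[pi]_z (Num.max (- c z) 0)%:E)%E.
  rewrite integralE; congr (_ - _)%E; apply: eq_integral => z _.
    by rewrite funeposE EFin_max.
  by rewrite funenegE EFin_max.
have mcp : measurable_fun setT (fun z => Num.max (c z) 0) by exact: measurable_maxr.
have mcn : measurable_fun setT (fun z => Num.max (- c z) 0).
  by apply: measurable_maxr => //; exact: measurableT_comp.
have cp0 : (0 <= \int[pi]_z (Num.max (c z) 0)%:E)%E.
  by apply: integral_ge0 => z _; rewrite lee_fin le_max lexx orbT.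
have cn0 : (0 <= \int[pi]_z (Num.max (- c z) 0)%:E)%E.
  by apply: integral_ge0 => z _; rewrite lee_fin le_max lexx orbT.
have [cnoo|] := eqVneq (\int[pi]_z (Num.max (- c z) 0)%:E)%E +oo%E.
  (* If $\int c^-\,d\pi=+\infty$, then $\int c^+\,d\pi$ is finite because the integral is defined,
     so $\int c\,d\pi=-\infty$. *)
  case: ic => [cpoo|]; last by rewrite cnoo ltxx.
  rewrite cnoo -(@fineK _ (\int[pi]_z (Num.max (c z) 0)%:E)%E) ?ge0_fin_numE//.
  by rewrite leNye.
rewrite -ltey => cnoo.
have icn : pi.-integrable setT (EFin \o (fun z => Num.max (- c z) 0)).
  apply/integrableP; split; first exact/measurable_EFinP.
  under eq_integral do rewrite /= ger0_norm ?le_max ?lexx ?orbT//.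
  exact: cnoo.
rewrite leeBlDr ?ge0_fin_numE//; apply/lee_addgt0Pr => e e0.
apply: integral_min_posr => // n.
have e20 : 0 < e / 2 by rewrite divr_gt0.
(* Chosen so that $e^{-K}\le e/2$; the absolute value makes $K\ge0$. *)
pose K := `|ln (e / 2)|.
have Ke : expR (- K) <= e / 2.
  rewrite -[leRHS]lnK ?posrE// ler_expR /K lerNl -normrN ler_norm//.
pose b z := Num.max (Num.min (c z) n%:R) (- K).
have mb : measurable_fun setT b by apply: measurable_maxr => //; exact: measurable_minr.
have K0 : 0 <= K by exact: normr_ge0.
have bM z : `|b z| <= n%:R + K.
  have n0 : 0 <= n%:R :> R by exact: ler0n.
  rewrite ler_norml /b le_max ge_max ge_min; apply/andP; split.
    by apply/orP; right; lra.
  by apply/andP; split; [apply/orP; right|]; lra.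
have ib : pi.-integrable setT (EFin \o b) by exact: (integrable_bounded (M := n%:R + K)).
have ieb : rho.-integrable setT (EFin \o (fun z => expR (b z))).
  apply: (integrable_bounded (M := expR (n%:R + K))) => //.
    exact: measurableT_comp.
  by move=> z; exact: expR_norm_le.
(* Cutting above by $n$ only lowers $e^c$ and cutting below by $-K$ adds at most $e^{-K}$, so
   $e^b\le e^c+e/2$; then integrate in $x$, using the normalization of [c]. *)
have hrho : \int[rho]_z expR (b z) <= 1 + e / 2.
  rewrite -lee_fin -EFin_Rintegral//.
  rewrite integral_prod_marginal//; last exact: measurableT_comp.
  rewrite -[leRHS](_ : (\int[pi]_z (1 + e / 2)%:E = _)%E); last first.
    rewrite EFin_Rintegral ?Rintegral_probability_cst//.
    by apply: (integrable_bounded (M := `|1 + e / 2|)).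
  apply: ge0_le_integral => //.
  - by move=> z _; apply: integral_ge0 => x _; rewrite lee_fin expR_ge0.
  - apply: (measurableT_comp (f := fun y => \int[nu]_x (expR (b (x, y)))%:E)%E) => //.
    apply: (measurable_fun_fubini_tonelli_G (m1 := nu) (EFin \o (fun z => expR (b z)))).
      by apply/measurable_EFinP; exact: measurableT_comp.
    by move=> z; rewrite lee_fin expR_ge0.
  move=> [_ y] _ /=.
  have msec (h : X * Y -> R) : measurable_fun setT h ->
      measurable_fun setT (fun x => h (x, y)).
    by move=> mh; exact: measurableT_comp.
  apply: (@le_trans _ _ (\int[nu]_x ((expR (c (x, y)))%:E + (e / 2)%:E))%E).
    apply: ge0_le_integral => //.
    - by apply/measurable_EFinP; apply: measurableT_comp => //; exact: msec.
    - apply: emeasurable_funD => //.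
      by apply/measurable_EFinP; apply: measurableT_comp => //; exact: msec.
    move=> x _; rewrite -EFinD lee_fin /b maxEle; case: ifP => _.
      by rewrite (le_trans Ke)// lerDr expR_ge0.
    by rewrite (@le_trans _ _ (expR (c (x, y))))// ?ler_expR ?ge_min ?lexx// lerDl ltW.
  rewrite ge0_integralD//.
  - rewrite cn EFin_Rintegral ?Rintegral_probability_cst -?EFinD//.
    by apply: (integrable_bounded (M := `|e / 2|)).
  - by apply/measurable_EFinP; apply: measurableT_comp => //; exact: msec.
  - by move=> x _; rewrite lee_fin ltW.
have [f [fl fn ff]] := normalized_lipschitz_bounded nu pi mX mY cX cY bX bY mb bM e20.
(* The two errors add up: $\int b\,d\pi-(1+e/2)+1-e/2=\int b\,d\pi-e\le\int f\,d\pi\le S$. *)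
have hb : ((\int[pi]_z b z)%:E <= S + e%:E)%E.
  rewrite -leeBlDr//; apply: le_trans (hS f fl fn).
  rewrite EFin_Rintegral.
    by rewrite -EFinB lee_fin (le_trans _ ff)//; move: hrho; rewrite -/rho; lra.
  have [M fM] := bounded_lipschitz mX mY cX cY fl.
  by apply: (integrable_bounded (M := M)) => //; exact: measurable_lipschitz_prod fl.
(* Pointwise $\min(c^+,n)\le b+c^-$: since $b\ge\min(c,n)$, this is clear where $c\ge0$, and where
   $c<0$ the left side is $0$ while $b\ge c=-c^-$. *)
apply: (@le_trans _ _ (\int[pi]_z ((b z)%:E + (Num.max (- c z) 0)%:E))%E).
  apply: ge0_le_integral => //.
  - by move=> z _; rewrite lee_fin le_min le_max lexx orbT ler0n.
  - by apply/measurable_EFinP; exact: measurable_minr.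
  - by apply: emeasurable_funD; exact/measurable_EFinP.
  move=> z _; rewrite -EFinD lee_fin /b.
  have [cz|] := boolP (0 <= c z).
    by rewrite (max_l cz) (max_r (_ : - c z <= 0)) ?oppr_le0// addr0 le_max lexx.
  rewrite -ltNge => cz.
  rewrite (max_r (ltW cz)) (max_l (_ : 0 <= - c z)); last by rewrite oppr_ge0 ltW.
  rewrite (min_l (ler0n R n)) subr_ge0 le_max le_min lexx/=.
  by rewrite (le_trans (ltW cz)).
rewrite integralD// EFin_Rintegral// addeAC.
by rewrite leeD2r.
Qed.

Unset Implicit Arguments.

(** * Equality of the two suprema *)

Theorem mainTheorem7 (R : realType) (d1 d2 : measure_display)
  (X : measurableType d1) (Y : measurableType d2)
  (dX : X -> X -> R) (dY : Y -> Y -> R)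
  (mX : is_metric dX) (mY : is_metric dY)
  (cX : metric_compact dX) (cY : metric_compact dY)
  (bX : borel_for dX) (bY : borel_for dY)
  (nu : probability X R) (pi : probability (X * Y)%type R) :
  Hnu nu pi =
  (- ereal_sup [set \int[pi]_z (f z)%:E | f in
      [set f : X * Y -> R | lipschitz_wrt (prod_dist dX dY) f /\ nu_normalized nu f]])%E.
Proof.
have pT : (pi setT < +oo)%E by rewrite probability_setT ltry.
rewrite /Hnu; congr (- _)%E; apply/eqP; rewrite eq_le; apply/andP; split.
  apply: ge_ereal_sup => _ [c [mc ic cn] <-].
  apply: (le_Hnu_lipschitz mX mY) => // f fl fn.
  by apply: ereal_sup_ubound; exists f.
apply: ge_ereal_sup => _ [f [fl fn] <-].
have mf : measurable_fun setT f := measurable_lipschitz_prod mX mY cX bX bY fl.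
(* A normalized Lipschitz function competes in [Hnu]: it is bounded and $\pi$ is finite, so its
   positive part has finite integral. *)
apply: ereal_sup_ubound; exists f => //; split => //; left.
have [M fM] := bounded_lipschitz mX mY cX cY fl.
apply: integrable_lty => //.
apply: (integrable_bounded (f := fun z => Num.max (f z) 0) (M := M)) => //.
- exact: measurable_maxr.
- move=> z; rewrite ger0_norm ?le_max ?lexx ?orbT// ge_max.
  by rewrite (le_trans (ler_norm _))//= (le_trans (normr_ge0 _) (fM z)).
Qed.
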